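(* Let $R$ be a ring. (1) If $\mathfrak{p} \in \operatorname{Min} R$, then $R_{\mathfrak{p}}$ has property $( ** )$ if and only if there is an Artinian local subring of $R_{\mathfrak{p}}$ over which $R_{\mathfrak{p}}$ is free (as a module). (2) If $R$ has property $( ** )$, then the set $\{ \operatorname{char} R_{\mathfrak{p}} \mid \mathfrak{p} \in \operatorname{Min} R \}$ is finite (as a subset of $\mathbb{Z}$).
   Context: All rings are commutative with $1 \neq 0$, and ring maps take $1$ to $1$ (so subrings contain the same $1$). A ring $A$ has property $( ** )$ if there exist a Noetherian ring $S$ and a flat ring map $S \to A$ (i.e. $A$ is flat as an $S$-module). $\operatorname{Min} R$ denotes the set of minimal primes of $R$. $\operatorname{char} A$ denotes the characteristic of $A$, i.e. the nonnegative generator of the kernel of $\mathbb{Z} \to A$. *)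

(* Defs.v *)
From HB Require Import structures.
From mathcomp Require Import all_boot all_order all_algebra.
From mathcomp Require Import generic_quotient ring_quotient.
From mathcomp Require Import boolp classical_sets cardinality.
From mathcomp Require freeg.

Set Implicit Arguments.
Unset Strict Implicit.
Unset Printing Implicit Defensive.

Import GRing.Theory.
Local Open Scope ring_scope.
Local Open Scope classical_set_scope.
Local Open Scope quotient_scope.

Section Ideals.
Variable A : comNzRingType.

(* The library's [idealr_closed] also asks for properness; here the unit ideal
   is an ideal. *)
Definition is_ideal (I : {pred A}) : Prop :=
  0 \in I /\ forall a, {in I &, forall u v, a * u + v \in I}.

Definition finitely_generated (I : {pred A}) : Prop :=
  exists s : seq A, forall x,
    x \in I <-> exists c : nat -> A, x = \sum_(i < size s) c i * s`_i.

Definition noetherian : Prop :=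
  forall I : {pred A}, is_ideal I -> finitely_generated I.

Definition artinian : Prop :=
  forall I : nat -> {pred A},
    (forall n, is_ideal (I n)) -> (forall n, {subset I n.+1 <= I n}) ->
    exists n, forall m, (n <= m)%N -> I m =i I n.

Definition maximal_ideal (I : {pred A}) : Prop :=
  [/\ is_ideal I, 1 \notin I &
      forall J : {pred A}, is_ideal J -> 1 \notin J -> {subset I <= J} ->
        J =i I].

Definition local_ring : Prop :=
  exists2 I : {pred A}, maximal_ideal I &
    forall J : {pred A}, maximal_ideal J -> J =i I.

Definition minimal_prime (P : prime_idealr A) : Prop :=
  forall Q : prime_idealr A, {subset Q <= P} -> Q =i P.

End Ideals.

Arguments noetherian : clear implicits.
Arguments artinian : clear implicits.
Arguments local_ring : clear implicits.

Section Characteristic.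
Variable A : nzRingType.

Definition char_spec (c : int) : Prop :=
  0 <= c /\ forall z : int, z%:~R = 0 :> A <-> (c %| z)%Z.

Lemma char_spec_ex : exists c, char_spec c.
Proof.
have [[n n0 nA]|noA] := pselect (exists2 n, (0 < n)%N & n%:R = 0 :> A); last first.
  exists 0; split=> // z; rewrite dvd0z; split=> [zA|/eqP->//].
  apply/negP => /negP z0; apply: noA; exists `|z|%N; first by rewrite absz_gt0.
  by case: (intP z) zA {z0} => [//|n|n] /=; rewrite ?abszN ?mulrNz //;
    move/eqP; rewrite ?oppr_eq0 => /eqP.
have ex : exists n, (0 < n)%N && (n%:R == 0 :> A).
  by exists n; rewrite n0 nA eqxx.
case: (ex_minnP ex) => m /andP[m0 /eqP mA] mmin.
exists m%:Z; split=> // z; split=> [zA|/dvdzP[q ->]]; last first.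
  by rewrite intrM -pmulrn mA mulr0.
have mz0 : m%:Z != 0 by rewrite eqz_nat -lt0n.
have rA : (z %% m)%Z%:~R = 0 :> A.
  by move: zA; rewrite {1}(divz_eq z m) intrD intrM -pmulrn mA mulr0 add0r.
apply/dvdz_mod0P; move: (modz_ge0 z mz0) (ltz_pmod z (d := m)) rA.
rewrite ltz_nat m0 => + /(_ isT).
case: (z %% m)%Z => // -[//|k] _; rewrite ltz_nat => km kA.
have /mmin : (0 < k.+1)%N && (k.+1%:R == 0 :> A) by rewrite /= pmulrn kA.
by rewrite leqNgt km.
Qed.

Definition ring_char : int := projT1 (cid char_spec_ex).

Lemma ring_charP : char_spec ring_char.
Proof. exact: projT2 (cid char_spec_ex). Qed.

End Characteristic.

(* [localization P] is R_P: pairs (r, s) with s outside P, where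
   (r, s) ~ (r', s') iff u (r s' - r' s) = 0 for some u outside P. *)
Module Localization.
Section Localization.
Variables (R : comNzRingType) (P : prime_idealr R).
Implicit Types (r s u : R).

Record fraction := Fraction { frac : R * R; _ : frac.2 \notin P }.

HB.instance Definition _ := [isSub for frac].
HB.instance Definition _ := [Choice of fraction by <:].

Local Notation num x := (frac x).1.
Local Notation den x := (frac x).2.

Lemma denP (x : fraction) : den x \notin P. Proof. by case: x. Qed.

Lemma notin1 : 1 \notin (P : pred R).
Proof. by rewrite idealr1. Qed.

Lemma notinM r s : r \notin P -> s \notin P -> r * s \notin P.
Proof. by move=> rP sP; rewrite prime_idealrM negb_or rP. Qed.

Definition frac_eq (x y : fraction) : bool :=
  `[< exists2 u, u \notin P & u * (num x * den y - num y * den x) = 0 >].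

Lemma frac_eqP x y :
  reflect (exists2 u, u \notin P & u * (num x * den y) = u * (num y * den x))
          (frac_eq x y).
Proof.
apply: (iffP (asboolP _)) => -[u uP e]; exists u => //.
  by apply/eqP; rewrite -subr_eq0 -mulrBr e.
by rewrite mulrBr e subrr.
Qed.

Lemma frac_eq_refl : reflexive frac_eq.
Proof. by move=> x; apply/frac_eqP; exists 1 => //; exact: notin1. Qed.

Lemma frac_eq_sym : symmetric frac_eq.
Proof. by move=> x y; apply/frac_eqP/frac_eqP => -[u uP e]; exists u. Qed.

Lemma frac_eq_trans : transitive frac_eq.
Proof.
move=> y x z /frac_eqP[u uP uE] /frac_eqP[v vP vE]; apply/frac_eqP.
exists (u * v * den y); first by rewrite !notinM ?denP.
transitivity (v * den z * (u * (num x * den y))).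
  by rewrite (AC (3*2) ((2*5)*(1*(4*3))))/=.
rewrite uE.
transitivity (u * den x * (v * (num y * den z))).
  by rewrite (AC (2*(1*2)) ((3*5)*(1*(4*2))))/=.
by rewrite vE (AC (2*(1*2)) (((1*3)*5)*(4*2)))/=.
Qed.

Canonical frac_eq_equiv :=
  EquivRel frac_eq frac_eq_refl frac_eq_sym frac_eq_trans.

Definition type := {eq_quot frac_eq}.

HB.instance Definition _ : EqQuotient _ frac_eq type := EqQuotient.on type.
HB.instance Definition _ := Choice.on type.

Definition add_frac (x y : fraction) : fraction :=
  @Fraction (num x * den y + num y * den x, den x * den y)
    (notinM (denP x) (denP y)).
Definition opp_frac (x : fraction) : fraction :=
  @Fraction (- num x, den x) (denP x).
Definition mul_frac (x y : fraction) : fraction :=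
  @Fraction (num x * num y, den x * den y) (notinM (denP x) (denP y)).

Definition embed r : fraction := @Fraction (r, 1) notin1.

Definition add := lift_op2 type add_frac.
Definition opp := lift_op1 type opp_frac.
Definition mul := lift_op2 type mul_frac.
Definition zero : type := lift_cst type (embed 0).
Definition one : type := lift_cst type (embed 1).
Canonical pi_zero_morph := PiConst zero.
Canonical pi_one_morph := PiConst one.

Lemma frac_repr x : exists2 u, u \notin P &
  u * (num (repr (\pi_type x)) * den x) = u * (num x * den (repr (\pi_type x))).
Proof. by apply/frac_eqP; rewrite -(@eqquotE _ _ type) reprK. Qed.

Lemma pi_add : {morph \pi : x y / add_frac x y >-> add x y}.
Proof.
move=> x y; unlock add; apply/eqmodP => /=; rewrite frac_eq_sym; apply/frac_eqP => /=.
have [u uP uE] := frac_repr x; have [v vP vE] := frac_repr y.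
move: (repr _) (repr _) uE vE => y' x' uE vE.
exists (u * v); rewrite ?notinM // !mulrDl !mulrDr; congr (_ + _).
  transitivity (v * den y * den y' * (u * (num x' * den x))).
    by rewrite (AC (2*(2*2)) ((2*6*4)*(1*(3*5))))/=.
  by rewrite uE (AC (3*(1*2)) ((4*1)*((5*2)*(6*3))))/=.
transitivity (u * den x * den x' * (v * (num y' * den y))).
  by rewrite (AC (2*(2*2)) ((1*5*4)*(2*(3*6))))/=.
by rewrite vE (AC (3*(1*2)) ((1*4)*((5*2)*(3*6))))/=.
Qed.
Canonical pi_add_morph := PiMorph2 pi_add.

Lemma pi_opp : {morph \pi : x / opp_frac x >-> opp x}.
Proof.
move=> x; unlock opp; apply/eqmodP => /=; rewrite frac_eq_sym; apply/frac_eqP => /=.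
have [u uP uE] := frac_repr x; exists u => //.
by rewrite !mulNr !mulrN uE.
Qed.
Canonical pi_opp_morph := PiMorph1 pi_opp.

Lemma pi_mul : {morph \pi : x y / mul_frac x y >-> mul x y}.
Proof.
move=> x y; unlock mul; apply/eqmodP => /=; rewrite frac_eq_sym; apply/frac_eqP => /=.
have [u uP uE] := frac_repr x; have [v vP vE] := frac_repr y.
move: (repr _) (repr _) uE vE => y' x' uE vE.
exists (u * v); rewrite ?notinM //.
transitivity ((u * (num x' * den x)) * (v * (num y' * den y))).
  by rewrite (AC (2*(2*2)) ((1*(3*5))*(2*(4*6))))/=.
by rewrite uE vE (AC ((1*2)*(1*2)) ((1*4)*((2*5)*(3*6))))/=.
Qed.
Canonical pi_mul_morph := PiMorph2 pi_mul.

Lemma eq_frac (x y : fraction) :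
  num x * den y = num y * den x -> \pi_type x = \pi_type y.
Proof.
by move=> e; apply/eqmodP/frac_eqP; exists 1; rewrite ?notin1 ?e.
Qed.

Lemma addA : associative add.
Proof.
elim/quotW=> x; elim/quotW=> y; elim/quotW=> z; rewrite !piE.
apply: eq_frac => /=; rewrite !mulrA; congr (_ * _ * _ * _).
by rewrite !mulrDl !addrA ![_ * _ * den x]mulrAC.
Qed.

Lemma addC : commutative add.
Proof.
elim/quotW=> x; elim/quotW=> y; rewrite !piE; apply: eq_frac => /=.
by rewrite addrC [den y * _]mulrC.
Qed.

Lemma add0 : left_id zero add.
Proof.
by elim/quotW=> x; rewrite !piE; apply: eq_frac => /=; rewrite mul0r add0r mulr1 mul1r.
Qed.

Lemma addN : left_inverse zero opp add.
Proof.
by elim/quotW=> x; rewrite !piE; apply: eq_frac => /=; rewrite mulNr addNr !mul0r.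
Qed.

HB.instance Definition _ := GRing.isZmodule.Build type addA addC add0 addN.

Lemma mulA : associative mul.
Proof.
elim/quotW=> x; elim/quotW=> y; elim/quotW=> z; rewrite !piE.
by apply: eq_frac => /=; rewrite !mulrA.
Qed.

Lemma mulC : commutative mul.
Proof.
elim/quotW=> x; elim/quotW=> y; rewrite !piE; apply: eq_frac => /=.
by rewrite [num x * _]mulrC [den x * _]mulrC.
Qed.

Lemma mul1 : left_id one mul.
Proof. by elim/quotW=> x; rewrite !piE; apply: eq_frac => /=; rewrite !mul1r. Qed.

Lemma mulDl : left_distributive mul add.
Proof.
elim/quotW=> x; elim/quotW=> y; elim/quotW=> z; rewrite !piE.
apply: eq_frac => /=; rewrite !mulrDl; congr (_ + _);
  by rewrite (AC (3*(2*2)) (((1*3)*(2*5))*((4*6)*7)))/=.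
Qed.

Lemma nonzero1 : one != zero.
Proof.
rewrite !piE; apply/negP => /frac_eqP[u uP] /=.
by rewrite !mulr1 mulr0 => u0; move: uP; rewrite u0 rpred0.
Qed.

HB.instance Definition _ :=
  GRing.Zmodule_isComNzRing.Build type mulA mulC mul1 mulDl nonzero1.

End Localization.
End Localization.
HB.export Localization.

Notation localization := Localization.type.

Section Subring.
Variables (L : comNzRingType) (B : subringClosed L).

Definition subring := {x : L | x \in B}.

HB.instance Definition _ := SubChoice.on subring.
HB.instance Definition _ := [SubChoice_isSubComNzRing of subring by <:].

Definition subring_incl : {rmorphism subring -> L} := (val : subring -> L).

End Subring.

(* [restr phi] is A viewed as an S-module along phi : S -> A. *)
Section RestrictScalars.
Variables (S A : comNzRingType) (phi : {rmorphism S -> A}).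

Definition restr_of of {rmorphism S -> A} : Type := A.
Local Notation restr := (restr_of phi).

HB.instance Definition _ := GRing.Zmodule.on restr.

Definition restr_scale (s : S) (a : restr) : restr := phi s * (a : A).

Fact restr_scaleA s t a :
  restr_scale s (restr_scale t a) = restr_scale (s * t) a.
Proof. by rewrite /restr_scale rmorphM mulrA. Qed.

Fact restr_scale1 : left_id 1 restr_scale.
Proof. by move=> a; rewrite /restr_scale rmorph1 mul1r. Qed.

Fact restr_scaleDr : right_distributive restr_scale +%R.
Proof. by move=> s a b; rewrite /restr_scale -mulrDr. Qed.

Fact restr_scaleDl a : {morph restr_scale^~ a : s t / s + t}.
Proof. by move=> s t; rewrite /restr_scale rmorphD mulrDl. Qed.

HB.instance Definition _ := GRing.Zmodule_isLmodule.Build S restr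
  restr_scaleA restr_scale1 restr_scaleDr restr_scaleDl.

End RestrictScalars.

Notation restr := restr_of.

(* The tensor product is the free abelian group on M * N modulo the subgroup
   generated by the bilinearity relations.  Only its additive group is needed:
   injectivity of f (x) N does not involve the S-action. *)
Section Tensor.
Import freeg.
Variables (S : comNzRingType) (M N : lmodType S).

Definition formal : lmodType int := {freeg (M * N)%type / int}.
Definition gen (m : M) (n : N) : formal := Freeg [:: (1, (m, n))].

Definition bilinear_rels (G : {pred formal}) : Prop :=
  [/\ forall m m' n, gen (m + m') n - gen m n - gen m' n \in G,
      forall m n n', gen m (n + n') - gen m n - gen m n' \in G &
      forall s m n, gen (s *: m) n - gen m (s *: n) \in G].

Definition rel_subgroup : {pred formal} :=
  fun x => `[< forall G : zmodClosed formal, bilinear_rels G -> x \in G >].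

Fact rel_subgroup_closed : zmod_closed rel_subgroup.
Proof.
split=> [|x y /asboolP xG /asboolP yG]; apply/asboolP => G relG.
  exact: rpred0.
by rewrite rpredB ?xG ?yG.
Qed.

HB.instance Definition _ :=
  GRing.isZmodClosed.Build formal rel_subgroup rel_subgroup_closed.

Definition tensor : zmodType := Quotient.quot rel_subgroup.
Definition pi_tensor : formal -> tensor := \pi_(Quotient.quot rel_subgroup).
Definition pure (m : M) (n : N) : tensor := pi_tensor (gen m n).

Lemma pi_tensor_eq x y : pi_tensor x = pi_tensor y <-> x - y \in rel_subgroup.
Proof.
rewrite (Quotient.idealrBE rel_subgroup x y).
by split=> [e|/eqP]; [apply/eqP|].
Qed.

Lemma pi_tensorB : zmod_morphism pi_tensor.
Proof. exact: pi_is_zmod_morphism. Qed.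

Lemma bilinear_rel_subgroup : bilinear_rels rel_subgroup.
Proof. by split=> *; apply/asboolP => G []. Qed.

Lemma pureDl m m' n : pure (m + m') n = pure m n + pure m' n.
Proof.
apply/eqP; rewrite -subr_eq -subr_eq0 -!pi_tensorB; apply/eqP.
rewrite -[RHS](subrr (pi_tensor 0)) -pi_tensorB; apply/pi_tensor_eq.
by rewrite !subr0 addrAC; case: bilinear_rel_subgroup.
Qed.

Lemma pureDr m n n' : pure m (n + n') = pure m n + pure m n'.
Proof.
apply/eqP; rewrite -subr_eq -subr_eq0 -!pi_tensorB; apply/eqP.
rewrite -[RHS](subrr (pi_tensor 0)) -pi_tensorB; apply/pi_tensor_eq.
by rewrite !subr0 addrAC; case: bilinear_rel_subgroup.
Qed.

Lemma pureZ s m n : pure (s *: m) n = pure m (s *: n).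
Proof. by apply/pi_tensor_eq; case: bilinear_rel_subgroup. Qed.

End Tensor.

Arguments rel_subgroup {S} M N.
Arguments tensor {S} M N.

(* f (x) N : M (x) N -> M' (x) N, sending m (x) n to f m (x) n. *)
Section TensorMap.
Import freeg.
Variables (S : comNzRingType) (M M' N : lmodType S) (f : {linear M -> M'}).

Definition formal_map : formal M N -> formal M' N :=
  fglift (fun mn : M * N => gen (f mn.1) mn.2).

Fact formal_mapB : zmod_morphism formal_map.
Proof. exact: lift_is_additive. Qed.

HB.instance Definition _ :=
  GRing.isZmodMorphism.Build (formal M N) (formal M' N) formal_map formal_mapB.

Lemma formal_map_gen m n : formal_map (gen m n) = gen (f m) n.
Proof. by rewrite /formal_map /gen liftU scale1r. Qed.

Lemma formal_map_rel x : x \in rel_subgroup M N -> formal_map x \in rel_subgroup M' N.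
Proof.
move=> /asboolP xG; apply/asboolP => G [rDl rDr rZ].
pose H : {pred formal M N} := fun x => formal_map x \in G.
have Hz : zmod_closed H.
  by split=> [|y z yH zH]; rewrite unfold_in ?raddf0 ?raddfB ?rpred0 ?rpredB.
pose HG : zmodClosed (formal M N) :=
  HB.pack H (GRing.isZmodClosed.Build (formal M N) H Hz).
apply: (xG HG); split=> *; rewrite unfold_in !raddfB /= !formal_map_gen.
- by rewrite linearD rDl.
- by rewrite rDr.
- by rewrite linearZ rZ.
Qed.

Definition tensor_map (t : tensor M N) : tensor M' N :=
  pi_tensor (formal_map (repr t)).

Lemma tensor_map_pi x : tensor_map (pi_tensor x) = pi_tensor (formal_map x).
Proof.
apply/pi_tensor_eq; rewrite -raddfB; apply/formal_map_rel/pi_tensor_eq.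
by rewrite /pi_tensor reprK.
Qed.

Lemma tensor_mapB : zmod_morphism tensor_map.
Proof.
move=> x y; rewrite -[x]reprK -[y]reprK -!/(pi_tensor _) -pi_tensorB.
by rewrite !tensor_map_pi raddfB pi_tensorB.
Qed.

Lemma tensor_map_pure m n : tensor_map (pure m n) = pure (f m) n.
Proof. by rewrite tensor_map_pi formal_map_gen. Qed.

End TensorMap.

Arguments tensor_map {S M M'} N f.

Definition flat (S : comNzRingType) (N : lmodType S) : Prop :=
  forall (M M' : lmodType S) (f : {linear M -> M'}),
    injective f -> injective (tensor_map N f).

Definition free_module (S : comNzRingType) (M : lmodType S) : Prop :=
  exists B : set M,
    (forall x, exists s : seq M, exists c : M -> S,
       [set` s] `<=` B /\ x = \sum_(b <- s) c b *: b) /\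
    (forall (s : seq M) (c : M -> S), uniq s -> [set` s] `<=` B ->
       \sum_(b <- s) c b *: b = 0 -> {in s, forall b, c b = 0}).

Definition flat_over_noetherian (A : comNzRingType) : Prop :=
  exists (S : comNzRingType) (phi : {rmorphism S -> A}),
    noetherian S /\ flat (restr phi).

(* Main.v *)
From HB Require Import structures.
Require Import Defs.
From mathcomp Require Import all_boot all_order all_algebra.
From mathcomp Require Import ring_quotient boolp classical_sets cardinality.

Set Implicit Arguments.
Unset Strict Implicit.
Unset Printing Implicit Defensive.

Import GRing.Theory.
Local Open Scope classical_set_scope.
Local Open Scope ring_scope.

(** Part 1.  A minimal prime [P] of [R] is the only prime inside itself, so in
    [A = localization P] every nonunit is nilpotent
    ([localization_nilprimary]).

    Let [S] be Noetherian and [phi : S -> A] flat.  The elements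
    [phi s / phi t] with [phi t] invertible form a subring [B] of [A].  Each
    ideal of [B] is generated by its numerators, so [B] is Noetherian; its
    nonunits are nilpotent because those of [A] are, so it is local and Artinian
    ([noetherian_artinian]).  [A] is flat over [B], since a relation over [B] can
    be multiplied by a common denominator ([fraction_ideal_flat]).  A flat module
    [M] over such a ring [B] with nilradical [n] is free ([ideal_flat_free]): lift
    a basis of [M / n M] over the residue field.  The lift spans [M] by Nakayama's
    lemma ([span_residue_basis]).  For independence, a nontrivial relation can be
    multiplied by a scalar so that its coefficients become nonzero elements of
    the annihilator [J] of [n].  Flatness makes it a relation in [J (x) M],
    where the coordinates modulo [n M] separate the coefficients
    ([independent_free]).

    Conversely, an Artinian ring is Noetherian ([artinian_noetherian]) and a free
    module is flat ([free_flat]).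

    Part 2.  The additive torsion of the Noetherian ring [S] is killed by a single
    positive integer [N] ([noetherian_torsion]).  If [R] is flat over [S], a
    relation [k x = 0] in [R] forces [x] into [Ann_S(k) R], so [N] kills the
    torsion of [R] too ([flat_torsion]).  When [localization P] has positive
    characteristic [c], some [u] outside [P] satisfies [c u = 0], hence [N u = 0],
    so [c] divides [N].  Only [0] and the divisors of [N] can occur.

    Flatness enters both parts through the injectivity of [J (x) M -> M] for an
    ideal [J], tested by balanced maps on [J * M] ([flat_ideal_flat]); the test
    maps replace computations in quotient modules. *)

(** * Finite combinations *)

(** The sums of terms [F v t] subject to [Q v t].  Both the linear span of a
    set and the tensors of the form sum of [m (x) b] are of this shape, and
    stating the constraint on the pair of a coefficient and a vector also gives
    spans modulo a submodule [n M]. *)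
Section Combinations.
Variables (V : zmodType) (T : choiceType) (Z : zmodType) (F : V -> T -> Z).

Inductive comb (Q : V -> T -> Prop) : Z -> Prop :=
| comb0 : comb Q 0
| comb_cons v t z : Q v t -> comb Q z -> comb Q (F v t + z).

Lemma combD Q x y : comb Q x -> comb Q y -> comb Q (x + y).
Proof.
by move=> + Qy; elim=> [|v t z Qvt _ IH]; rewrite ?add0r // -addrA; apply: comb_cons.
Qed.

Lemma comb1 Q v t : Q v t -> comb Q (F v t).
Proof. by move=> Qvt; rewrite -[F v t]addr0; apply: comb_cons Qvt (comb0 Q). Qed.

Lemma comb_sum Q (I : eqType) (r : seq I) (G : I -> Z) :
  {in r, forall i, comb Q (G i)} -> comb Q (\sum_(i <- r) G i).
Proof.
elim: r => [|i r IH] H; rewrite ?big_nil ?big_cons; first exact: comb0.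
apply: combD; first by apply: H; rewrite mem_head.
by apply: IH => j jr; apply: H; rewrite in_cons jr orbT.
Qed.

Lemma sub_comb Q Q' z :
  (forall v t, Q v t -> Q' v t) -> comb Q z -> comb Q' z.
Proof. by move=> QQ'; elim=> [|v t y /QQ' H _]; [exact: comb0|exact: comb_cons]. Qed.

(** Terms with the same second component are merged, since [F] is additive in
    the first one. *)
Lemma comb_uniq (X : set T) z :
  (forall t, {morph F^~ t : v w / v + w}) -> comb (fun _ t => X t) z ->
  exists s (c : T -> V), [/\ uniq s, [set` s] `<=` X & z = \sum_(t <- s) F (c t) t].
Proof.
move=> FD; have F0 t : F 0 t = 0.
  by apply: (@addrI _ (F 0 t)); rewrite -FD !addr0.
elim=> [|v t y Xt _ [s [c [us sX ->]]]].
  by exists [::], (fun=> 0); split; rewrite ?big_nil.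
pose d u := (if u == t then v else 0) + (if u \in s then c u else 0).
have dE : \sum_(u <- s | u != t) F (c u) u = \sum_(u <- s | u != t) F (d u) u.
  rewrite big_seq_cond [RHS]big_seq_cond; apply: eq_bigr => u /andP[us' ut].
  by rewrite /d (negPf ut) us' add0r.
have [ts|ts] := boolP (t \in s).
  exists s, d; split=> //.
  rewrite (bigD1_seq t) //= [RHS](bigD1_seq t) //= -dE addrA; congr (_ + _).
  by rewrite /d eqxx ts FD.
exists (t :: s), d; split; rewrite /= ?ts //.
  by move=> u /=; rewrite in_cons => /orP[/eqP->//|/sX].
rewrite big_cons /d eqxx (negPf ts) addr0; congr (_ + _).
rewrite !big_seq; apply: eq_bigr => u us'; rewrite us'.
by case: eqP us' => [->|_ _]; rewrite ?(negPf ts) ?add0r.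
Qed.

(** Only finitely many elements of [T] are involved in a combination, so a
    union of a chain supports nothing that no member of the chain supports. *)
Lemma comb_bigcup (Q : set T -> V -> T -> Prop) (F0 : set (set T)) z :
  (forall X Y v t, X `<=` Y -> Q X v t -> Q Y v t) ->
  (forall v t, Q (\bigcup_(X in F0) X) v t -> exists2 X, F0 X & Q X v t) ->
  total_on F0 subset -> F0 !=set0 -> comb (Q (\bigcup_(X in F0) X)) z ->
  exists2 X, F0 X & comb (Q X) z.
Proof.
move=> mono fin tot [X0 FX0]; elim=> [|v t y /fin[X FX Qvt] _ [Y FY Qy]].
  by exists X0 => //; apply: comb0.
case: (tot X Y FX FY) => XY.
  by exists Y => //; apply: (comb_cons _ Qy); apply: mono Qvt.
by exists X => //; apply: (comb_cons Qvt); apply: sub_comb Qy => ? ?; apply: mono.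
Qed.

End Combinations.

Section Span.
Variables (S : comNzRingType) (M : lmodType S).

Notation lincomb := (comb (fun (c : S) (b : M) => c *: b)).

Definition span (X : set M) : M -> Prop := lincomb (fun _ b => X b).

Lemma lincombZ (Q : S -> M -> Prop) a x :
  (forall c b, Q c b -> Q (a * c) b) -> lincomb Q x -> lincomb Q (a *: x).
Proof.
move=> QZ; elim=> [|c b y /QZ Qcb _ IH]; rewrite ?scaler0; first exact: comb0.
by rewrite scalerDr scalerA; apply: comb_cons.
Qed.

Lemma lincomb_sub (Q : S -> M -> Prop) x y :
  (forall a c b, Q c b -> Q (a * c) b) -> lincomb Q x -> lincomb Q y ->
  lincomb Q (x - y).
Proof.
move=> QZ Qx Qy; apply: combD => //; rewrite -scaleN1r.
by apply: lincombZ Qy => ? ?; apply: QZ.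
Qed.

Lemma lincomb_add_vector (Q Q' : S -> M -> Prop) a x :
  (forall c b, Q' c b -> b = a \/ Q c b) -> lincomb Q' x ->
  exists c, lincomb Q (x - c *: a).
Proof.
move=> QQ'; elim=> [|c b y /QQ' Qcb _ [d Qy]].
  by exists 0; rewrite scale0r subr0; apply: comb0.
case: Qcb => [->|Qcb].
  by exists (c + d); rewrite scalerDl opprD addrACA subrr add0r.
by exists d; rewrite -addrA; apply: comb_cons.
Qed.

Lemma spanZ X a x : span X x -> span X (a *: x).
Proof. exact: lincombZ. Qed.

Lemma spanB X x y : span X x -> span X y -> span X (x - y).
Proof. exact: lincomb_sub. Qed.

Lemma mem_span (X : set M) x : X x -> span X x.
Proof.
move=> Xx; rewrite -[x]scale1r.
exact: (@comb1 _ _ _ (fun (c : S) (b : M) => c *: b)).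
Qed.

Lemma span_mono (X Y : set M) x : X `<=` Y -> span X x -> span Y x.
Proof. by move=> XY; apply: sub_comb => _ ?; apply: XY. Qed.

Lemma span_add_vector X a x : span (X `|` [set a]) x -> exists c, span X (x - c *: a).
Proof. by apply: lincomb_add_vector => _ b [|->]; [right|left]. Qed.

Lemma span_bigcup (F : set (set M)) x :
  total_on F subset -> F !=set0 -> span (\bigcup_(X in F) X) x ->
  exists2 X, F X & span X x.
Proof.
apply: (@comb_bigcup _ _ _ _ (fun X _ b => X b)) => [X Y _ b XY|_ b [X FX Xb]].
  exact: XY.
by exists X.
Qed.

(** The additivity and linearity defects of an arbitrary choice of coordinates
    along [e] are scalars [c] with [c e] in [W].  If [e] belongs to a basis and
    [W] is spanned by the other vectors, such a [c] is zero; for a basis modulo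
    the nilradical it is nilpotent. *)
Lemma coordinate (e : M) (W : M -> Prop) :
  (forall x y, W x -> W y -> W (x - y)) -> (forall a x, W x -> W (a *: x)) ->
  (forall x, exists c, W (x - c *: e)) ->
  exists psi : M -> S,
    [/\ forall x y, W ((psi (x + y) - (psi x + psi y)) *: e),
        forall a x, W ((psi (a *: x) - a * psi x) *: e),
        W ((psi e - 1) *: e) &
        forall x, W x -> W (psi x *: e)].
Proof.
move=> WB WZ /choice[psi psiW]; exists psi; split=> [x y|a x||x Wx].
- have -> : (psi (x + y) - (psi x + psi y)) *: e =
    (x - psi x *: e) - ((x + y - psi (x + y) *: e) - (y - psi y *: e)).
    rewrite scalerBl scalerDl.
    set u := psi (x + y) *: e; set v := psi x *: e; set w := psi y *: e.
    rewrite !opprD !opprK [RHS](AC (2*(3*2)) ((1*3)*(6*4)*(5*(2*7))))/=.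
    by rewrite !subrr !add0r.
  by apply: (WB _ _ (psiW x)); apply: WB.
- rewrite scalerBl -scalerA.
  have -> : psi (a *: x) *: e - a *: (psi x *: e) =
    a *: (x - psi x *: e) - (a *: x - psi (a *: x) *: e).
    by rewrite scalerBr opprB [RHS]addrC addrA subrK.
  by apply: WB => //; apply: WZ.
- by rewrite scalerBl scale1r -opprB -scaleN1r; apply: WZ.
- have -> : psi x *: e = x - (x - psi x *: e) by rewrite opprB addrC subrK.
  exact: WB.
Qed.

End Span.

(** * Flat modules *)

Section TensorElements.
Variables (S : comNzRingType) (M N : lmodType S).

HB.instance Definition _ := GRing.isZmodMorphism.Build (formal M N) (tensor M N)
  (@pi_tensor S M N) (@pi_tensorB S M N).

Lemma pure0l n : pure (0 : M) n = 0 :> tensor M N.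
Proof. by apply: (@addrI _ (pure 0 n)); rewrite -pureDl !addr0. Qed.

Lemma pure0r m : pure m (0 : N) = 0 :> tensor M N.
Proof. by apply: (@addrI _ (pure m 0)); rewrite -pureDr !addr0. Qed.

Lemma pure_sumr (I : Type) (r : seq I) m (n : I -> N) :
  pure m (\sum_(i <- r) n i) = \sum_(i <- r) pure m (n i) :> tensor M N.
Proof. by apply: (big_morph (pure m)) => [? ?|]; [exact: pureDr|exact: pure0r]. Qed.

(** Negation is absorbed into the left factor of a pure tensor. *)
Lemma tensor_comb (t : tensor M N) : comb (@pure S M N) (fun _ _ => True) t.
Proof.
rewrite -[t]reprK -/(pi_tensor _) -(freeg.freeg_sumE (repr t)) raddf_sum.
apply: comb_sum => -[m n] _; set k := freeg.coeff _ _; move: k => k.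
suff [m' E] : exists m', pi_tensor (freeg.Freeg [:: (k, (m, n))]) = pure m' n.
  rewrite [X in comb _ _ X]E.
  exact: comb1.
have -> : freeg.Freeg [:: (k, (m, n))] = gen m n *~ k.
  by rewrite /gen freeg.freegU_mulz intz.
have natE j : pi_tensor (gen m n) *+ j = pure (m *+ j) n.
  elim: j => [|j IH]; first by rewrite !mulr0n pure0l.
  by rewrite !mulrS pureDl IH.
rewrite raddfMz; case: k => j; first by exists (m *+ j); exact: natE.
exists (- (m *+ j.+1)); rewrite NegzE mulrNz -pmulrn natE.
by apply/esym/eqP; rewrite -addr_eq0 -pureDl addNr pure0l.
Qed.

(** The universal property of the tensor product, in the form in which it shows
    that a given sum of pure tensors is not zero. *)
Lemma tensor_balanced (Z : zmodType) (beta : M -> N -> Z) :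
  (forall n, {morph beta^~ n : m m' / m + m'}) ->
  (forall m, {morph beta m : n n' / n + n'}) ->
  (forall s m n, beta (s *: m) n = beta m (s *: n)) ->
  forall (I : Type) (r : seq I) (m : I -> M) (n : I -> N),
  \sum_(i <- r) pure (m i) (n i) = 0 -> \sum_(i <- r) beta (m i) (n i) = 0.
Proof.
move=> bDl bDr bZ I r m n sum0.
pose L : formal M N -> zmodule Z :=
  freeg.fglift (fun mn : M * N => beta mn.1 mn.2 : zmodule Z).
have LB : zmod_morphism L by exact: freeg.lift_is_additive.
pose HL := GRing.isZmodMorphism.Build (formal M N) (zmodule Z) L LB.
pose LA : {additive formal M N -> zmodule Z} := HB.pack L HL.
have Lgen a b : LA (gen a b) = beta a b by rewrite /= /L /gen freeg.liftU scale1r.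
pose G : {pred formal M N} := fun x => LA x == 0.
have Gz : zmod_closed G.
  split=> [|x y]; rewrite !unfold_in ?raddf0 // raddfB.
  by move=> /eqP-> /eqP->; rewrite subrr.
pose GG : zmodClosed (formal M N) :=
  HB.pack G (GRing.isZmodClosed.Build (formal M N) G Gz).
have: pi_tensor (\sum_(i <- r) gen (m i) (n i)) = pi_tensor 0.
  by rewrite raddf_sum raddf0.
move=> /pi_tensor_eq; rewrite subr0 => /asboolP /(_ GG).
have relG : bilinear_rels GG.
  split=> *; rewrite unfold_in !raddfB !Lgen subr_eq0.
  - by rewrite bDl [beta _ _ + _]addrC addrK.
  - by rewrite bDr [beta _ _ + _]addrC addrK.
  - by rewrite bZ.
move=> /(_ relG); rewrite unfold_in raddf_sum => /eqP.
by rewrite (eq_bigr (fun i => beta (m i) (n i))) // => i _; rewrite Lgen.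
Qed.

End TensorElements.

HB.instance Definition _ (S : comNzRingType) (M M' N : lmodType S)
  (f : {linear M -> M'}) :=
  GRing.isZmodMorphism.Build (tensor M N) (tensor M' N) (tensor_map N f)
    (@tensor_mapB S M M' N f).

Section SubIdeal.
Variables (S : comNzRingType) (J : submodClosed S^o).
Definition sub_ideal := {x : S^o | x \in J}.
HB.instance Definition _ := SubChoice.on sub_ideal.
HB.instance Definition _ := [SubChoice_isSubLmodule of sub_ideal by <:].
Definition sub_ideal_incl : {linear sub_ideal -> S^o} := (val : sub_ideal -> S^o).
End SubIdeal.

(** Injectivity of [J (x) N -> N], phrased through maps out of [J (x) N]: a
    balanced map on [J * N] kills the elements that die in [N]. *)
Definition ideal_flat (S : comNzRingType) (N : lmodType S) : Prop :=
  forall J : {pred S}, is_ideal J ->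
  forall (Z : zmodType) (beta : S -> N -> Z),
  (forall n, {in J &, {morph beta^~ n : x y / x + y}}) ->
  {in J, forall x, {morph beta x : n n' / n + n'}} ->
  (forall s n, {in J, forall x, beta (s * x) n = beta x (s *: n)}) ->
  forall (I : eqType) (r : seq I) (c : I -> S) (m : I -> N),
  {in r, forall i, c i \in J} -> \sum_(i <- r) c i *: m i = 0 ->
  \sum_(i <- r) beta (c i) (m i) = 0.

(** Flatness is applied to the inclusion [J -> S], after which
    [c (x) m = 1 (x) c m] in [S (x) N]. *)
Lemma flat_ideal_flat (S : comNzRingType) (N : lmodType S) : flat N -> ideal_flat N.
Proof.
move=> flatN J [J0 Jlin] Z beta bDl bDr bZ I r c m cJ sum0.
have Jsub : submod_closed (J : {pred S^o}).
  by split=> // a u v uJ vJ; apply: Jlin.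
pose JJ : submodClosed S^o :=
  HB.pack J (GRing.isSubmodClosed.Build S S^o J Jsub).
pose d i : sub_ideal JJ := insubd 0 (c i).
have dE i : i \in r -> val (d i) = c i by move=> ir; rewrite insubdK //; apply: cJ.
have balE : \sum_(i <- r) pure (d i) (m i) = 0 :> tensor _ N ->
    \sum_(i <- r) beta (val (d i)) (m i) = 0.
  apply: (tensor_balanced (beta := fun x : sub_ideal JJ => beta (val x))).
  - by move=> n x y; rewrite -bDl ?(valP x) ?(valP y).
  - by move=> x; apply: bDr; apply: (valP x).
  - by move=> s x n; rewrite -bZ ?(valP x).
transitivity (\sum_(i <- r) beta (val (d i)) (m i)).
  by rewrite !big_seq; apply: eq_bigr => i ir; rewrite dE.
apply: balE.
apply: (flatN _ _ (sub_ideal_incl JJ)); first exact: val_inj.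
rewrite raddf0 raddf_sum.
transitivity (\sum_(i <- r) pure (1 : S^o) (c i *: m i) : tensor S^o N).
  rewrite !big_seq; apply: eq_bigr => i ir; rewrite -pureZ /= tensor_map_pure /= dE //.
  by congr (pure _ _); rewrite -[RHS]/(c i * 1) mulr1.
by rewrite -pure_sumr sum0 pure0r.
Qed.

Section FreeFlat.
Variables (S : comNzRingType) (N : lmodType S) (E : set N).
Hypothesis spanE : forall x, span E x.
Hypothesis freeE : forall (s : seq N) (c : N -> S), uniq s -> [set` s] `<=` E ->
  \sum_(b <- s) c b *: b = 0 -> {in s, forall b, c b = 0}.

Lemma basis_coordinate e : E e -> exists psi : N -> S,
  [/\ {morph psi : x y / x + y}, forall a x, psi (a *: x) = a * psi x, psi e = 1 &
      forall b, E b -> b != e -> psi b = 0].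
Proof.
move=> Ee; pose W := span (E `\ e).
have W0 c : W (c *: e) -> c = 0.
  move=> /(comb_uniq (@scalerDl S _))[s [d [us sE ce]]].
  pose d' b := if b == e then - c else d b.
  have es : e \notin s by apply/negP => /sE[_]; apply.
  have /(_ e) : {in e :: s, forall b, d' b = 0}.
    apply: freeE; first by rewrite /= es us.
      by move=> b /=; rewrite in_cons => /orP[/eqP->|/sE[]].
    rewrite big_cons {1}/d' eqxx scaleNr ce addrC; apply/eqP; rewrite subr_eq0.
    apply/eqP; rewrite !big_seq; apply: eq_bigr => b bs; rewrite /d'.
    by case: eqP => // be; rewrite -be bs in es.
  by rewrite mem_head /d' eqxx => /(_ isT)/eqP; rewrite oppr_eq0 => /eqP.
have [||x|psi [pD pZ p1 pW]] := @coordinate _ _ e W.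
- exact: spanB.
- exact: spanZ.
- apply: (lincomb_add_vector _ (spanE x)) => c b Eb.
  by have [->|/eqP be] := eqVneq b e; [left|right].
have eq0 a b : W ((a - b) *: e) -> a = b.
  by move=> /W0/eqP; rewrite subr_eq0 => /eqP.
exists psi; split=> [x y|a x||b Eb be].
- exact: eq0.
- exact: eq0.
- exact: eq0.
- by apply/W0/pW/mem_span; split=> // /eqP; exact/negP.
Qed.

(** Every tensor is a sum of [d b (x) b] over distinct basis vectors [b].  The
    coordinate along [e] sends its image under [f] to [f (d e)], so each [d e]
    vanishes when the image does. *)
Lemma basis_flat : flat N.
Proof.
move=> M M' f finj t1 t2 ft; apply/eqP; rewrite -subr_eq0; apply/eqP.
have {ft} : tensor_map N f (t1 - t2) = 0 by rewrite raddfB /= ft subrr.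
move: (t1 - t2) => {t1 t2} t ft0.
have tE0 : comb (@pure S M N) (fun _ b => E b) t.
  elim: (tensor_comb t) => [|m n z _ _ IH]; first exact: comb0.
  apply: combD IH; elim: (spanE n) m => [|c b x Eb _ IH] m.
    by rewrite pure0r; apply: comb0.
  by rewrite pureDr -pureZ; apply: comb_cons.
have [s [d [us sE tE]]] := comb_uniq (fun b m m' => pureDl m m' b) tE0.
rewrite tE big_seq big1 // => e es; have Ee : E e := sE e es.
have [psi [pD pZ p1 p0]] := basis_coordinate Ee.
suff -> : d e = 0 by rewrite pure0l.
apply: finj; rewrite raddf0.
have : \sum_(b <- s) psi b *: f (d b) = 0.
  apply: (tensor_balanced (beta := fun m n => psi n *: m)) => [n m m'|m n n'|a m n|].
  - exact: scalerDr.
  - by rewrite pD scalerDl.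
  - by rewrite pZ !scalerA mulrC.
  rewrite -[RHS]ft0 tE raddf_sum.
  by apply: eq_bigr => b _; rewrite /= tensor_map_pure.
rewrite (bigD1_seq e) //= p1 scale1r big_seq_cond big1 ?addr0 // => b /andP[bs be].
by rewrite p0 ?scale0r //; apply: sE.
Qed.

End FreeFlat.

Lemma span_free_module (S : comNzRingType) (M : lmodType S) :
  free_module M <-> exists E : set M, (forall x, span E x) /\
    (forall (s : seq M) (c : M -> S), uniq s -> [set` s] `<=` E ->
       \sum_(b <- s) c b *: b = 0 -> {in s, forall b, c b = 0}).
Proof.
split=> -[E [spanE freeE]]; exists E; split=> // x.
  have [s [c [sE ->]]] := spanE x; apply: comb_sum => b bs.
  by apply: (@comb1 _ _ _ (fun (c : S) (b : M) => c *: b)); apply: sE.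
have [s [c [_ sE ->]]] := comb_uniq (@scalerDl S _) (spanE x).
by exists s, c.
Qed.

Lemma free_flat (S : comNzRingType) (N : lmodType S) : free_module N -> flat N.
Proof. by move=> /span_free_module[E [spanE freeE]]; apply: (basis_flat spanE). Qed.

(** * Chain conditions *)

Section ChainConditions.
Variable A : comNzRingType.
Implicit Types (I J : {pred A}) (C : {pred A} -> Prop).

Notation ispan := (@span A A^o).

Lemma idealD I x y : is_ideal I -> x \in I -> y \in I -> x + y \in I.
Proof. by move=> [_ Ilin] xI yI; rewrite -[x]mul1r; apply: Ilin. Qed.

Lemma idealM I a x : is_ideal I -> x \in I -> a * x \in I.
Proof. by move=> [I0 Ilin] xI; rewrite -[a * x]addr0; apply: Ilin. Qed.

Lemma idealB I x y : is_ideal I -> x \in I -> y \in I -> x - y \in I.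
Proof. by move=> II xI yI; apply: idealD => //; rewrite -mulN1r; apply: idealM. Qed.

Lemma ideal_sum I (K : eqType) (r : seq K) (F : K -> A) :
  is_ideal I -> {in r, forall i, F i \in I} -> \sum_(i <- r) F i \in I.
Proof.
move=> II FI; rewrite big_seq; elim/big_rec: _ => [|i x ir xI]; first by case: II.
by apply: idealD => //; apply: FI.
Qed.

Lemma ideal_span I (X : set A) x :
  is_ideal I -> (forall b, X b -> b \in I) -> ispan X x -> x \in I.
Proof.
move=> II XI; elim=> [|c b y Xb _ yI]; first by case: II.
by apply: idealD => //; apply: idealM => //; apply: XI.
Qed.

Lemma span_ideal (X : set A) : is_ideal [pred x : A | `[< ispan X x >]].
Proof.
split=> [|a x y]; first by apply/asboolP; exact: comb0.
by move=> /asboolP Xx /asboolP Xy; apply/asboolP/combD => //; apply: (spanZ a Xx).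
Qed.

Lemma finitely_generatedP I : is_ideal I -> finitely_generated I <->
  exists s : seq A, {subset s <= I} /\ {in I, forall x, ispan [set` s] x}.
Proof.
move=> II; split=> [[s sI]|[s [sI Is]]]; exists s.
  split=> [x /(nthP 0)[i ilt <-]|x /sI[c ->]].
    apply/sI; exists (fun j => (j == i)%:R).
    rewrite (bigD1 (Ordinal ilt)) //= eqxx mul1r big1 ?addr0 // => j /negPf ji.
    by rewrite -[_ == _]/(j == Ordinal ilt) ji mul0r.
  apply: comb_sum => i _.
  by apply: (@comb1 _ _ _ (fun (c : A) (b : A^o) => c *: b)); apply: mem_nth.
move=> x; split=> [/Is|[c ->]]; last first.
  by apply: ideal_sum => // i _; apply: idealM => //; apply: sI; apply: mem_nth.
elim=> [|a b y /= bs _ [c ->]].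
  by exists (fun=> 0); rewrite big1 // => i _; rewrite mul0r.
exists (fun j => (if j == index b s then a else 0) + c j).
rewrite [RHS](eq_bigr (fun i : 'I_(size s) =>
  (if i == index b s :> nat then a else 0) * s`_i + c i * s`_i)); last first.
  by move=> i _; rewrite mulrDl.
rewrite big_split /=; congr (_ + _).
have blt : (index b s < size s)%N by rewrite index_mem.
rewrite (bigD1 (Ordinal blt)) //= eqxx nth_index // big1 ?addr0 // => j /negPf ji.
by rewrite -[_ == _]/(j == Ordinal blt) ji mul0r.
Qed.

Lemma artinian_minimal C : artinian A -> (exists2 I, is_ideal I & C I) ->
  exists I, [/\ is_ideal I, C I &
    forall J, is_ideal J -> C J -> {subset J <= I} -> {subset I <= J}].
Proof.
move=> artA [I0 I0id CI0]; apply: contrapT => nomin.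
pose T := {I : {pred A} | is_ideal I /\ C I}.
have /choice[f fP] (I : T) : exists J : T,
    {subset sval J <= sval I} /\ ~ {subset sval I <= sval J}.
  apply: contrapT => noJ; apply: nomin; exists (sval I).
  case: I noJ => I [Iid CI] noJ /=; split=> // J Jid CJ JI.
  by apply: contrapT => IJ; apply: noJ; exists (exist _ J (conj Jid CJ)).
pose I n : T := iter n f (exist _ I0 (conj I0id CI0)).
have [|n|n stab] := artA (fun n => sval (I n)).
- by move=> n; have [] := svalP (I n).
- by have [] := fP (I n).
- by have [_] := fP (I n); apply=> x xI; rewrite -[f _]/(I n.+1) stab.
Qed.

Lemma noetherian_maximal C : noetherian A -> (exists2 I, is_ideal I & C I) ->
  exists I, [/\ is_ideal I, C I &
    forall J, is_ideal J -> C J -> {subset I <= J} -> {subset J <= I}].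
Proof.
move=> noethA [I0 I0id CI0]; apply: contrapT => nomax.
pose T := {I : {pred A} | is_ideal I /\ C I}.
have /choice[f fP] (I : T) : exists J : T,
    {subset sval I <= sval J} /\ ~ {subset sval J <= sval I}.
  apply: contrapT => noJ; apply: nomax; exists (sval I).
  case: I noJ => I [Iid CI] noJ /=; split=> // J Jid CJ JI.
  by apply: contrapT => IJ; apply: noJ; exists (exist _ J (conj Jid CJ)).
pose I n : T := iter n f (exist _ I0 (conj I0id CI0)).
have Iid n : is_ideal (sval (I n)) by have [] := svalP (I n).
have mono m n : (m <= n)%N -> {subset sval (I m) <= sval (I n)}.
  move=> /subnK <-; elim: (n - m)%N => // k IH x /IH.
  by have [+ _] := fP (I (k + m)%N); apply.
pose U : {pred A} := [pred x | `[< exists n, x \in sval (I n) >]].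
have Uid : is_ideal U.
  split=> [|a x y].
    by apply/asboolP; exists 0%N; case: (Iid 0%N).
  move=> /asboolP[m xI] /asboolP[n yI]; apply/asboolP; exists (maxn m n).
  apply: (idealD (Iid _)); first apply: (idealM _ (Iid _)).
    by apply: mono xI; rewrite leq_maxl.
  by apply: mono yI; rewrite leq_maxr.
have [s [sU Us]] := (finitely_generatedP Uid).1 (noethA U Uid).
have [n sI] : exists n, {subset s <= sval (I n)}.
  elim: s sU {Us} => [|x s IH] sU; first by exists 0%N.
  have [|n sI] := IH; first by move=> y ys; apply: sU; rewrite in_cons ys orbT.
  have := sU x; rewrite mem_head => /(_ isT) /asboolP[m xI].
  exists (maxn m n) => y; rewrite in_cons => /orP[/eqP->|/sI].
    by apply: mono xI; rewrite leq_maxl.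
  by apply: mono; rewrite leq_maxr.
have [_] := fP (I n); apply=> x xI; apply: (ideal_span (Iid n) sI); apply: Us.
by apply/asboolP; exists n.+1.
Qed.

End ChainConditions.

(** A smallest ideal [I] that is not finitely generated satisfies [c I = I] or
    [c I = 0] for every scalar [c], since [c I] and the kernel of multiplication
    by [c] on [I] are not both finitely generated, and one that is not equals [I]
    by minimality.  By the descending chain
    condition on the powers of [c], the first case makes [c] invertible on [I],
    so [I] is a vector space over the residue field of its annihilator.  A
    hyperplane of [I] is finitely generated by minimality, and then so is [I]. *)
Lemma artinian_noetherian (A : comNzRingType) : artinian A -> noetherian A.
Proof.
move=> artA I0 I0id; apply: contrapT => nfgI0.
have [I [Iid nfgI minI]] := artinian_minimal artA
  (ex_intro2 _ (fun I => ~ finitely_generated I) I0 I0id nfgI0).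
have fgsub J : is_ideal J -> {subset J <= I} ->
    finitely_generated J \/ {subset I <= J}.
  by move=> Jid JI; have [|/(minI J Jid)] := pselect (finitely_generated J); auto.
have mulI c : {in I, forall x, c * x = 0} \/
    {in I, forall x, exists2 y, y \in I & x = c * y}.
  pose J : {pred A} := [pred x | `[< exists2 y, y \in I & x = c * y >]].
  pose K : {pred A} := [pred y | `[< y \in I /\ c * y = 0 >]].
  have Jid : is_ideal J.
    split=> [|a x y].
      by apply/asboolP; exists 0; rewrite ?mulr0 //; case: Iid.
    move=> /asboolP[x' x'I ->] /asboolP[y' y'I ->]; apply/asboolP.
    exists (a * x' + y'); last by rewrite mulrDr !mulrA [c * a]mulrC.
    by case: Iid => _; apply.
  have Kid : is_ideal K.
    split=> [|a x y].
      by apply/asboolP; rewrite mulr0; case: Iid.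
    move=> /asboolP[xI x0] /asboolP[yI y0]; apply/asboolP; split.
      by case: Iid => _; apply.
    by rewrite mulrDr mulrCA x0 y0 mulr0 addr0.
  have [|fgJ|IJ] := fgsub J Jid; last by right=> x /IJ/asboolP.
    by move=> x /asboolP[y yI ->]; apply: idealM.
  have [|fgK|IK] := fgsub K Kid; last by left=> x /IK/asboolP[].
    by move=> x /asboolP[].
  case: nfgI; apply/(finitely_generatedP Iid).
  have [k [kK Kk]] := (finitely_generatedP Kid).1 fgK.
  have [s [sJ Js]] := (finitely_generatedP Jid).1 fgJ.
  have [u uI sE] : exists2 u : seq A, {subset u <= I} & s = [seq c * y | y <- u].
    elim: s sJ {Js} => [|x s IH] sJ; first by exists [::].
    have [|u uI ->] := IH; first by move=> y ys; apply: sJ; rewrite in_cons ys orbT.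
    have := sJ x; rewrite mem_head => /(_ isT)/asboolP[y yI ->].
    by exists (y :: u) => // z; rewrite in_cons => /orP[/eqP->//|/uI].
  exists (u ++ k); split=> [x|x xI].
    by rewrite mem_cat => /orP[/uI//|/kK/asboolP[]].
  have lift z : span (M := A^o) [set` s] z ->
      exists2 y, span (M := A^o) [set` u] y & z = c * y.
    elim=> [|a b y /= bs _ [y' y'u ->]].
      by exists 0; [exact: comb0|rewrite mulr0].
    move: bs; rewrite sE => /mapP[b' b'u ->]; exists (a * b' + y').
      exact: (@comb_cons _ _ _ (fun (c : A) (b : A^o) => c *: b)).
    by rewrite mulrDr mulrCA.
  have /Js/lift[y yu cxy] : c * x \in J by apply/asboolP; exists x.
  have yI : y \in I by apply: (ideal_span Iid uI yu).
  have /Kk xyk : x - y \in K.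
    by apply/asboolP; rewrite mulrBr cxy subrr; split=> //; apply: idealB.
  rewrite -(subrK y x) addrC; apply: combD; [move: yu|move: xyk];
    by apply: span_mono => z; rewrite /= mem_cat => ->; rewrite ?orbT.
have [v vI v0] : exists2 v, v \in I & v <> 0.
  apply: contrapT => Iz; apply: nfgI; apply/(finitely_generatedP Iid).
  exists [::]; split=> // x xI; have [->|/eqP x0] := eqVneq x 0; first exact: comb0.
  by case: Iz; exists x.
pose P (X : set A) := X `<=` [set` I] /\ ~ span (M := A^o) X v.
have [F FP totF|H [[HI Hv] maxH]] := @Zorn_bigcup _ P.
  split=> [x [X /FP[XI _] /XI]//|spv].
  have [F0|/nonemptyPn F0] := pselect (F !=set0).
    have [X FX] := @span_bigcup A A^o F v totF F0 spv.
    by have [_] := FP X FX.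
  move: spv; rewrite F0 bigcup_set0 => spv; apply: v0.
  by elim: spv.
pose Hp : {pred A} := [pred x : A | `[< span (M := A^o) H x >]].
have Hid : is_ideal Hp by exact: span_ideal.
have HpI : {subset Hp <= I} by move=> x /asboolP; apply: ideal_span.
have [//|fgH|/(_ v vI)/asboolP//] := fgsub Hp Hid.
have [h [hH Hh]] := (finitely_generatedP Hid).1 fgH.
apply: nfgI; apply/(finitely_generatedP Iid); exists (v :: h); split.
  by move=> x; rewrite in_cons => /orP[/eqP->//|/hH/HpI].
have spanh x : span (M := A^o) H x -> span (M := A^o) [set` v :: h] x.
  move=> Hx; have /Hh : x \in Hp by exact/asboolP.
  by apply: span_mono => z /= zh; rewrite in_cons zh orbT.
move=> w wI; have [/spanh//|Hw] := pselect (span (M := A^o) H w).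
have [c Hvc] : exists c, span (M := A^o) H (v - c * w).
  apply: (@span_add_vector A A^o); apply: contrapT => spv.
  apply: (maxH (H `|` [set w])); last first.
    by split=> // x [/HI|->].
  split=> [x Hx|Hsub]; first by left.
  by apply: Hw; apply: (@mem_span A A^o); apply: Hsub; right.
case: (mulI c) => [cI|cI]; first by case: Hv; move: Hvc; rewrite cI // subr0.
(* [c] acts on [I] with inverse [y] *)
have [y yc] : exists y, {in I, forall z, z = y * (c * z)}.
  pose J n : {pred A} := [pred x | `[< exists y, x = c ^+ n * y >]].
  have [n|n x /asboolP[y ->]|n stab] := artA J.
  - split=> [|a x y]; first by apply/asboolP; exists 0; rewrite mulr0.
    move=> /asboolP[x' ->] /asboolP[y' ->]; apply/asboolP.
    by exists (a * x' + y'); rewrite mulrDr mulrCA.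
  - by apply/asboolP; exists (c * y); rewrite mulrA -exprSr.
  have /asboolP[y cE] : c ^+ n \in J n.+1.
    by rewrite stab //; apply/asboolP; exists 1; rewrite mulr1.
  exists y => z zI.
  have [z' -> ] : exists z', z = c ^+ n * z'.
    suff [z' _ ->] : exists2 z', z' \in I & z = c ^+ n * z' by exists z'.
    elim: n {stab cE} => [|n [z' /cI[z2 z2I ->] ->]].
      by exists z => //; rewrite expr0 mul1r.
    by exists z2 => //; rewrite exprSr mulrA.
  by rewrite {1}cE exprS [LHS](AC 4 (3*(1*(2*4)))).
rewrite (yc w wI) -[c * w](subKr v).
apply: (@spanZ A A^o); apply: (@spanB A A^o); last exact: spanh.
by apply: (@mem_span A A^o); exact: mem_head.
Qed.

(** * Rings whose nonunits are nilpotent *)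

Section NilpotentNonunits.
Variable A : comNzRingType.

Definition nilpotent (x : A) : Prop := exists n, x ^+ n = 0.

(** The local rings whose maximal ideal is nil. *)
Definition nilprimary : Prop := forall x : A, (exists y, x * y = 1) \/ nilpotent x.

Lemma nilpotentM a x : nilpotent x -> nilpotent (a * x).
Proof. by move=> [n xn]; exists n; rewrite exprMn xn mulr0. Qed.

Lemma nilpotentD x y : nilpotent x -> nilpotent y -> nilpotent (x + y).
Proof.
move=> [m xm] [n yn]; exists (m + n)%N; rewrite exprDn big1 // => i _.
have [ni|/ltnW lin] := leqP n i.
  by rewrite -(subnK ni) exprD yn !mulr0 mul0rn.
by rewrite -addnBA // exprD xm !mul0r mul0rn.
Qed.

Lemma nilpotent0 : nilpotent 0.
Proof. by exists 1%N. Qed.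

Lemma nilpotent_nonunit x y : nilpotent x -> x * y <> 1.
Proof.
move=> [n xn] xy; have /eqP := oner_neq0 A; apply.
by rewrite -(expr1n A n) -xy exprMn xn mul0r.
Qed.

Definition nilradical : {pred A} := [pred x | `[< nilpotent x >]].

Lemma nilradical_ideal : is_ideal nilradical.
Proof.
split=> [|a x y]; first by apply/asboolP; exact: nilpotent0.
move=> /asboolP xn /asboolP yn; apply/asboolP.
by apply: nilpotentD => //; apply: nilpotentM.
Qed.

Lemma nilprimary_local : nilprimary -> local_ring A.
Proof.
move=> npA; have nil1 : 1 \notin nilradical.
  by apply/negP => /asboolP/nilpotent_nonunit/(_ (mulr1 1)).
have proper_nil (J : {pred A}) : is_ideal J -> 1 \notin J -> {subset J <= nilradical}.
  move=> Jid J1 x xJ; apply/asboolP; case: (npA x) => // -[y xy].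
  by case/negP: J1; rewrite -xy mulrC; apply: idealM.
exists nilradical => [|J [Jid J1 Jmax] x].
  split=> // [|J Jid J1 nJ x]; first exact: nilradical_ideal.
  by apply/idP/idP; [exact: proper_nil|exact: nJ].
by rewrite (Jmax nilradical) //; [exact: nilradical_ideal|exact: proper_nil].
Qed.

(** Since the nilradical is generated by finitely many nilpotent elements, the
    annihilator of the nilradical in the nonzero module [A / J] is not zero. *)
Lemma noetherian_socle (J : {pred A}) : noetherian A -> is_ideal J -> 1 \notin J ->
  exists2 c, c \notin J & forall x, nilpotent x -> x * c \in J.
Proof.
move=> noethA Jid J1.
have [s [sn ns]] :=
  (finitely_generatedP nilradical_ideal).1 (noethA _ nilradical_ideal).
suff [c cJ sc] : exists2 c, c \notin J & {in s, forall x, x * c \in J}.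
  exists c => // x /asboolP/ns.
  elim=> [|a b y bs _ yJ]; first by rewrite mul0r; case: Jid.
  by rewrite mulrDl; apply: idealD => //; rewrite -mulrA; apply: idealM => //; apply: sc.
elim: s sn {ns} => [|x s IH] sn; first by exists 1.
have [|c cJ sc] := IH; first by move=> y ys; apply: sn; rewrite in_cons ys orbT.
have exn : exists n, x ^+ n * c \in J.
  have := sn x; rewrite mem_head => /(_ isT)/asboolP[n xn].
  by exists n; rewrite xn mul0r; case: Jid.
case: (ex_minnP exn) => -[|n] xnJ minn; first by rewrite mul1r (negPf cJ) in xnJ.
exists (x ^+ n * c).
  by apply/negP => /minn; rewrite ltnn.
move=> y; rewrite in_cons => /orP[/eqP->|ys]; first by rewrite mulrA -exprS.
by rewrite mulrCA; apply: idealM => //; apply: sc.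
Qed.

(** If the ring is not Artinian, let [J] be maximal among the ideals below every
    member of some descending chain that does not stabilize.  If [y x] is in [J]
    but neither factor is, chains above [J + (x)] and above [J : x] stabilize,
    hence so do chains above [J].  Thus [J] is prime, so it contains the
    nilpotent elements, and every ideal strictly above [J] contains a unit. *)
Lemma noetherian_artinian : nilprimary -> noetherian A -> artinian A.
Proof.
move=> npA noethA; pose stable (I : nat -> {pred A}) :=
  exists n, forall m, (n <= m)%N -> I m =i I n.
pose C (J : {pred A}) := exists I : nat -> {pred A},
  [/\ forall n, is_ideal (I n), forall n, {subset I n.+1 <= I n},
      forall n, {subset J <= I n} & ~ stable I].
suff noC J : is_ideal J -> ~ C J.
  move=> I Iid Isub; apply: contrapT => unstable.
  pose Z : {pred A} := pred1 0.
  apply: (noC Z).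
    by split=> [|a u v]; rewrite ?inE // => /eqP-> /eqP->; rewrite mulr0 addr0.
  exists I; split=> // n x; rewrite inE => /eqP->; by case: (Iid n).
move=> Jid CJ; have {J Jid CJ} [J [Jid [I [Iid Isub JI unstable]] maxJ]] :=
  noetherian_maximal noethA (ex_intro2 _ C J Jid CJ).
have mono m n : (m <= n)%N -> {subset I n <= I m}.
  by move=> /subnK <-; elim: (n - m)%N => // k IH x /Isub/IH.
have above (J' : {pred A}) z : is_ideal J' -> {subset J <= J'} -> z \in J' ->
    z \notin J -> forall I', (forall n, is_ideal (I' n)) ->
    (forall n, {subset I' n.+1 <= I' n}) -> (forall n, {subset J' <= I' n}) ->
    stable I'.
  move=> J'id JJ' zJ' zJ I' I'id I'sub J'I'; apply: contrapT => unst.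
  case/negP: zJ; apply: (maxJ J') => //; exists I'; split=> //.
have primeJ x y : x \notin J -> y * x \in J -> y \in J.
  move=> xJ yxJ; apply: contraT => yJ; case: unstable.
  pose plus (K : {pred A}) : {pred A} :=
    [pred z | `[< exists2 w, w \in K & exists a, z = w + a * x >]].
  pose colon (K : {pred A}) : {pred A} := [pred a | a * x \in K].
  have plusid K : is_ideal K -> is_ideal (plus K).
    move=> Kid; split=> [|a u v].
      by apply/asboolP; exists 0; [case: Kid|exists 0; rewrite mul0r addr0].
    move=> /asboolP[w wK [b ->]] /asboolP[w' w'K [b' ->]]; apply/asboolP.
    exists (a * w + w'); first by case: Kid => _; apply.
    by exists (a * b + b'); rewrite mulrDr mulrDl mulrA addrACA.
  have colonid K : is_ideal K -> is_ideal (colon K).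
    move=> Kid; split=> [|a u v]; rewrite !inE; first by rewrite mul0r; case: Kid.
    by rewrite mulrDl -mulrA; case: Kid => _; apply.
  have plussub (K L : {pred A}) : {subset K <= L} -> {subset plus K <= plus L}.
    by move=> KL z /asboolP[w /KL wL zE]; apply/asboolP; exists w.
  have colonsub (K L : {pred A}) : {subset K <= L} -> {subset colon K <= colon L}.
    by move=> KL z; rewrite !inE; apply: KL.
  have [n1 stab1] : stable (fun n => plus (I n)).
    apply: (above (plus J) x) => // [|z zJ||n|n|n]; auto.
      by apply/asboolP; exists z => //; exists 0; rewrite mul0r addr0.
    apply/asboolP; exists 0; first by case: Jid.
    by exists 1; rewrite mul1r add0r.
  have [n2 stab2] : stable (fun n => colon (I n)).
    apply: (above (colon J) y) => // [|z zJ|n|n|n]; auto.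
    by rewrite !inE mulrC; apply: idealM.
  exists (maxn n1 n2) => m lem u; apply/idP/idP; first exact: mono.
  have [le1 le2] : (n1 <= m)%N /\ (n2 <= m)%N by move: lem; rewrite geq_max => /andP.
  move=> uI; have : u \in plus (I m).
    rewrite stab1 // -(stab1 (maxn n1 n2)) ?leq_maxl //; apply/asboolP.
    by exists u => //; exists 0; rewrite mul0r addr0.
  move=> /asboolP[w wI [a uE]]; rewrite uE; apply: (idealD (Iid m)) => //.
  have : a \in colon (I (maxn n1 n2)).
    rewrite inE; have -> : a * x = u - w by rewrite uE addrC addKr.
    by apply: (idealB (Iid _)) => //; apply: mono wI.
  by rewrite stab2 ?leq_maxr // -(stab2 m).
have nilJ x : nilpotent x -> x \in J.
  move=> [n xn]; apply: contraT => xJ.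
  have J0 : x ^+ n \in J by rewrite xn; case: Jid.
  have : 1 \in J.
    elim: n J0 {xn} => [|n IH]; rewrite ?expr0 // exprSr => /(primeJ _ _ xJ).
    exact: IH.
  by move=> J1; rewrite -[x]mulr1 idealM in xJ.
case: unstable.
have [In|allunit] := pselect (exists n, {in I n, forall x, nilpotent x}).
  case: In => n In; exists n => m nm x; apply/idP/idP; first exact: mono.
  by move=> /In/nilJ/JI.
have full n x : x \in I n.
  have [y yI ny] : exists2 y, y \in I n & ~ nilpotent y.
    apply: contrapT => H; apply: allunit; exists n => y yI.
    by apply: contrapT => ny; apply: H; exists y.
  case: (npA y) => // -[z yz].
  by rewrite -[x]mulr1 -yz [y * z]mulrC mulrA; apply: idealM.
by exists 0%N => m _ x; rewrite !full.
Qed.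

End NilpotentNonunits.

(** * Flat modules over Artinian local rings *)

Section FlatFree.
Variables (B : comNzRingType) (M : lmodType B).
Hypotheses (npB : nilprimary B) (noethB : noetherian B) (flatM : ideal_flat M).

Notation lincomb := (comb (fun (c : B) (b : M) => c *: b)).

(** The submodule [span X + n M], where [n] is the nilradical. *)
Definition span_mod_nil (X : set M) : M -> Prop :=
  lincomb (fun c b => X b \/ nilpotent c).

Lemma span_mod_nilZ X a x : span_mod_nil X x -> span_mod_nil X (a *: x).
Proof. by apply: lincombZ => c b [|/(nilpotentM a)]; [left|right]. Qed.

Lemma span_mod_nilB X x y :
  span_mod_nil X x -> span_mod_nil X y -> span_mod_nil X (x - y).
Proof. by apply: lincomb_sub => a c b [|/(nilpotentM a)]; [left|right]. Qed.

Lemma mem_span_mod_nil (X : set M) x : X x -> span_mod_nil X x.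
Proof.
move=> Xx; rewrite -[x]scale1r.
by apply: (@comb1 _ _ _ (fun (c : B) (b : M) => c *: b)); left.
Qed.

Lemma span_mod_nil_mono (X Y : set M) x :
  X `<=` Y -> span_mod_nil X x -> span_mod_nil Y x.
Proof. by move=> XY; apply: sub_comb => c b [/XY|]; [left|right]. Qed.

Lemma span_mod_nil_add (X Y : set M) a x :
  (forall b, Y b -> b = a \/ X b) -> span_mod_nil Y x ->
  exists c, span_mod_nil X (x - c *: a).
Proof.
by move=> YX; apply: lincomb_add_vector => c b [/YX[]|]; [left|right; left|right; right].
Qed.

Lemma span_mod_nil_unit X c x : ~ span_mod_nil X x -> span_mod_nil X (c *: x) ->
  nilpotent c.
Proof.
move=> Xx Xcx; case: (npB c) => // -[y cy]; case: Xx.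
by rewrite -[x]scale1r -cy mulrC -scalerA; apply: span_mod_nilZ.
Qed.

(** Linear independence over the residue field in [M / n M]: no member is spanned
    by the others. *)
Definition independent (X : set M) : Prop :=
  forall e, X e -> ~ span_mod_nil (X `\ e) e.

(** A maximal independent set, by Zorn's lemma and the exchange argument. *)
Lemma residue_basis :
  exists2 E : set M, independent E & forall x, span_mod_nil E x.
Proof.
have [F Find totF e [X0 FX0 X0e] spe|E [indE maxE]] := @Zorn_bigcup M independent.
  have [X FX Xe] : exists2 X, F X & span_mod_nil (X `\ e) e.
    move: spe; apply: (@comb_bigcup _ _ _ _
      (fun X c b => (X `\ e) b \/ nilpotent c)) => //; last by exists X0.
      by move=> X Y c b XY [[/XY Yb be]|]; [left|right].
    move=> c b [[[X FX Xb] be]|nc]; first by exists X => //; left.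
    by exists X0 => //; right.
  have [XX0|X0X] := totF X X0 FX FX0.
    apply: (Find X0 FX0 e X0e); apply: span_mod_nil_mono Xe => b [/XX0 X0b be].
    by split.
  by apply: (Find X FX e) Xe; apply: X0X.
exists E => // a; apply: contrapT => Ea.
apply: (maxE (E `|` [set a])).
  split=> [x Ex|sub]; first by left.
  by apply/Ea/mem_span_mod_nil/sub; right.
move=> e [Ee|->] spe; last first.
  by apply: Ea; apply: span_mod_nil_mono spe => b [[//|->] /(_ erefl)].
have [|c cP] := @span_mod_nil_add (E `\ e) _ a _ _ spe.
  by move=> b [[Eb|->] be]; [right|left].
(* if [c] is nilpotent, then [e] depends on the rest of [E]; otherwise [a]
   depends on [E] *)
have nc : nilpotent c.
  apply: span_mod_nil_unit Ea _.
  rewrite -[c *: a](subKr e); apply: span_mod_nilB; first exact: mem_span_mod_nil.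
  by apply: span_mod_nil_mono cP => b [].
apply: (indE e Ee); rewrite -[X in span_mod_nil _ X](subrK (c *: a)); apply: (combD cP).
by apply: (@comb1 _ _ _ (fun (c : B) (b : M) => c *: b)); right.
Qed.

(** Nakayama's lemma: if [M <> span E], let [J] be the annihilator of
    [M / span E].  Some scalar [c] outside [J] satisfies [n c M <= span E], and
    multiplying [M = span E + n M] by [c] gives [c M <= span E]. *)
Lemma span_residue_basis (E : set M) : (forall x, span_mod_nil E x) ->
  forall x, span E x.
Proof.
move=> spE; pose J : {pred B} := [pred c | `[< forall x : M, span E (c *: x) >]].
have Jid : is_ideal J.
  split=> [|a u v]; first by apply/asboolP => x; rewrite scale0r; apply: comb0.
  move=> /asboolP uJ /asboolP vJ; apply/asboolP => x; rewrite scalerDl -scalerA.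
  exact: (combD (spanZ a (uJ x)) (vJ x)).
have [/asboolP J1 x|J1] := boolP (1 \in J); first by rewrite -[x]scale1r; apply: J1.
have [c cJ nc] := noetherian_socle noethB Jid J1; case/negP: cJ.
apply/asboolP => x; elim: (spE x) => [|a b y ab _ IH].
  by rewrite scaler0; apply: comb0.
rewrite scalerDr; apply: combD => //; case: ab => [Eb|na].
  by rewrite scalerA; apply/spanZ/mem_span.
by rewrite scalerA mulrC; have /asboolP := nc a na; apply.
Qed.

(** Let [s] carry a nontrivial relation.  After multiplying by a scalar, its
    coefficients [c b] are nonzero and lie in the annihilator [J] of [n].  If
    [psi] is the coordinate along [e], which is linear modulo [n], then
    [x * psi m] is balanced on [J * M], so [sum c b * psi b] vanishes; but it
    equals [c e]. *)
Lemma independent_free (E : set M) : independent E -> (forall x, span_mod_nil E x) ->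
  forall (s : seq M) (c : M -> B), uniq s -> [set` s] `<=` E ->
  \sum_(b <- s) c b *: b = 0 -> {in s, forall b, c b = 0}.
Proof.
move=> indE spE s c us sE sum0.
pose A : {pred B} := [pred y | `[< {in s, forall b, y * c b = 0} >]].
have Aid : is_ideal A.
  split=> [|a u v]; first by apply/asboolP => b _; rewrite mul0r.
  move=> /asboolP uA /asboolP vA; apply/asboolP => b bs.
  by rewrite mulrDl -mulrA uA // vA // mulr0 addr0.
have [/asboolP A1 b bs|A1] := boolP (1 \in A); first by rewrite -[c b]mul1r A1.
have [d dA nd] := noetherian_socle noethB Aid A1; case/negP: dA.
apply/asboolP => e es.
pose J : {pred B} := [pred y | `[< forall x, nilpotent x -> y * x = 0 >]].
have Jid : is_ideal J.
  split=> [|a u v]; first by apply/asboolP => x _; rewrite mul0r.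
  move=> /asboolP uJ /asboolP vJ; apply/asboolP => x nx.
  by rewrite mulrDl -mulrA uJ // vJ // mulr0 addr0.
have Ee : E e := sE e es.
have [||x|psi [pD pZ p1 p0]] := @coordinate _ _ e (span_mod_nil (E `\ e)).
- exact: span_mod_nilB.
- exact: span_mod_nilZ.
- apply: span_mod_nil_add (spE x) => b Eb.
  by have [->|/eqP be] := eqVneq b e; [left|right].
have nilW a : span_mod_nil (E `\ e) (a *: e) -> nilpotent a.
  exact: span_mod_nil_unit (indE e Ee).
have Jeq y u v : y \in J -> span_mod_nil (E `\ e) ((u - v) *: e) -> y * u = y * v.
  move=> /asboolP yJ /nilW/yJ/eqP; rewrite mulrBr subr_eq0 => /eqP; exact.
have cJ : {in s, forall b, d * c b \in J}.
  move=> b bs; apply/asboolP => x /nd/asboolP/(_ b bs) <-.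
  by rewrite mulrC mulrA.
have : \sum_(b <- s) (d * c b) * psi b = 0.
  apply: (flatM Jid (beta := fun y m => y * psi m)) => //.
  - by move=> m x y _ _; rewrite mulrDl.
  - by move=> y yJ m m'; rewrite -mulrDr; apply: Jeq.
  - by move=> a m y yJ; rewrite (Jeq _ _ _ yJ (pZ a m)) mulrCA mulrA.
  rewrite (eq_bigr (fun b => d *: (c b *: b))) => [|b _]; last by rewrite scalerA.
  by rewrite -scaler_sumr sum0 scaler0.
rewrite (bigD1_seq e) //= (Jeq _ _ 1) ?mulr1 ?cJ //.
rewrite big_seq_cond big1 ?addr0 // => b /andP[bs be].
rewrite (Jeq _ _ 0) ?mulr0 ?cJ // subr0; apply/p0/mem_span_mod_nil.
by split; [exact: sE|exact/eqP].
Qed.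

Lemma ideal_flat_free : free_module M.
Proof.
have [E indE spE] := residue_basis; apply/span_free_module; exists E; split.
  exact: span_residue_basis.
exact: independent_free.
Qed.

End FlatFree.

(** * The subring of fractions of an image *)

Section FractionSubring.
Variables (S A : comNzRingType) (phi : {rmorphism S -> A}).

(** The image of the localization of [S] at the preimage of the units of [A]. *)
Definition image_fractions : {pred A} :=
  [pred a | `[< exists s t, (exists y, phi t * y = 1) /\ a * phi t = phi s >]].

Fact image_fractions_subring : subring_closed image_fractions.
Proof.
split=> [|a b|a b].
- apply/asboolP; exists 1, 1; rewrite rmorph1 mulr1; split=> //.
  by exists 1; rewrite mulr1.
- move=> /asboolP[s [t [[y ty] at_s]]] /asboolP[s' [t' [[y' ty'] bt_s]]].
  apply/asboolP; exists (s * t' - s' * t), (t * t'); split.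
    by exists (y * y'); rewrite rmorphM mulrACA ty ty' mulr1.
  by rewrite rmorphB !rmorphM -at_s -bt_s mulrBl mulrA -[_ * _ * phi t]mulrA
    [phi t' * _]mulrC.
- move=> /asboolP[s [t [[y ty] at_s]]] /asboolP[s' [t' [[y' ty'] bt_s]]].
  apply/asboolP; exists (s * s'), (t * t'); split.
    by exists (y * y'); rewrite rmorphM mulrACA ty ty' mulr1.
  by rewrite !rmorphM mulrACA at_s bt_s.
Qed.

HB.instance Definition _ :=
  GRing.isSubringClosed.Build A image_fractions image_fractions_subring.

Definition fraction_subring : subringClosed A := image_fractions.

Notation B := (subring fraction_subring).

Lemma phi_image_fractions s : phi s \in fraction_subring.
Proof.
apply/asboolP; exists s, 1; rewrite rmorph1 mulr1; split=> //.
by exists 1; rewrite mulr1.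
Qed.

Definition to_fraction s : B := exist _ (phi s) (phi_image_fractions s).

Lemma to_fractionD s t : to_fraction (s + t) = to_fraction s + to_fraction t.
Proof. by apply: val_inj; rewrite /= rmorphD. Qed.

Lemma to_fractionM s t : to_fraction (s * t) = to_fraction s * to_fraction t.
Proof. by apply: val_inj; rewrite /= rmorphM. Qed.

Lemma to_fraction0 : to_fraction 0 = 0.
Proof. by apply: val_inj; rewrite /= rmorph0. Qed.

Lemma to_fraction1 : to_fraction 1 = 1.
Proof. by apply: val_inj; rewrite /= rmorph1. Qed.

Lemma to_fraction_unit t : (exists y, phi t * y = 1) -> exists y, to_fraction t * y = 1.
Proof.
move=> [y ty]; have yB : y \in fraction_subring.
  apply/asboolP; exists 1, t; split; first by exists y.
  by rewrite rmorph1 mulrC.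
by exists (exist _ y yB); apply: val_inj.
Qed.

Lemma fractionP (b : B) :
  exists s t, (exists y, to_fraction t * y = 1) /\ b * to_fraction t = to_fraction s.
Proof.
case: b => a aB; have /asboolP[s [t [tu at_s]]] := aB.
by exists s, t; split; [exact: to_fraction_unit|exact: val_inj].
Qed.

Lemma common_denominator (r : seq B) : exists t,
  (exists y, to_fraction t * y = 1) /\
  {in r, forall b, exists s, b * to_fraction t = to_fraction s}.
Proof.
elim: r => [|b r [t [[y ty] IH]]].
  by exists 1; split=> //; exists 1; rewrite to_fraction1 mulr1.
have [s' [t' [[y' ty'] bt']]] := fractionP b; exists (t * t'); split.
  by exists (y * y'); rewrite to_fractionM mulrACA ty ty' mulr1.
move=> b'; rewrite in_cons => /orP[/eqP->|/IH[s bs]].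
  by exists (s' * t); rewrite !to_fractionM -bt' mulrA mulrAC.
by exists (s * t'); rewrite !to_fractionM -bs mulrA.
Qed.

Lemma fraction_nilprimary : nilprimary A -> nilprimary B.
Proof.
move=> npA b; case: (npA (val b)) => [[y by1]|[n bn]]; last first.
  by right; exists n; apply: val_inj; rewrite rmorphXn.
left; have [s [t [[y' ty'] bt]]] := fractionP b.
have /to_fraction_unit[z sz] : exists z, phi s * z = 1.
  exists (y * val y'); have <- : val b * phi t = phi s by exact: (congr1 val bt).
  by rewrite mulrACA by1 mul1r; apply: (congr1 val ty').
by exists (to_fraction t * z); rewrite mulrA bt.
Qed.

(** An ideal of fractions is generated by the numerators in it. *)
Lemma fraction_noetherian : noetherian S -> noetherian B.
Proof.
move=> noethS I Iid; pose J : {pred S} := [pred s | to_fraction s \in I].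
have Jid : is_ideal J.
  split=> [|a u v uJ vJ]; first by rewrite inE to_fraction0; case: Iid.
  by rewrite inE to_fractionD to_fractionM; case: Iid => _; apply.
have [s [sJ Js]] := (finitely_generatedP Jid).1 (noethS J Jid).
apply/(finitely_generatedP Iid); exists (map to_fraction s); split.
  by move=> _ /mapP[x xs ->]; have := sJ x xs; rewrite inE.
move=> b bI; have [x [t [[y ty] bt]]] := fractionP b.
have /Js xs : x \in J by rewrite inE -bt mulrC; apply: idealM.
have -> : b = y * to_fraction x by rewrite -bt mulrCA [y * _]mulrC ty mulr1.
apply: (@spanZ B B^o); elim: xs => [|a c z /= cs _ IH].
  by rewrite to_fraction0; apply: comb0.
rewrite to_fractionD to_fractionM.
by apply: (@comb_cons _ _ _ (fun (c : B) (b : B^o) => c *: b)) => //=; apply: map_f.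
Qed.

(** Multiplying the coefficients of a relation by a common denominator and its
    vectors by the inverse turns it into a relation over [S], and a balanced map
    does not see the difference. *)
Lemma fraction_ideal_flat :
  ideal_flat (restr phi) -> ideal_flat (restr (subring_incl fraction_subring)).
Proof.
move=> flatA J Jid Z beta bDl bDr bZ I r c m cJ sum0.
pose J' : {pred S} := [pred s | to_fraction s \in J].
have J'id : is_ideal J'.
  split=> [|a u v uJ vJ]; first by rewrite inE to_fraction0; case: Jid.
  by rewrite inE to_fractionD to_fractionM; case: Jid => _; apply.
have [t [[y ty] ct]] := common_denominator (map c r).
have /choice[s sP] i : exists s, i \in r -> c i * to_fraction t = to_fraction s.
  have [ir|ir] := boolP (i \in r); last by exists 0.
  by have [s cs] := ct _ (map_f c ir); exists s.
have vty : val (to_fraction t) * val y = 1 := congr1 val ty.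
have /(flatA J' J'id Z (fun s (a : A) => beta (to_fraction s) a)) H :
  forall n : A, {in J' &, {morph (fun x => beta (to_fraction x) n) : x z / x + z}}.
  by move=> n x z xJ zJ; rewrite to_fractionD bDl.
have sumE : \sum_(i <- r) beta (to_fraction (s i)) (y *: m i) = 0.
  apply: (H _ _ I r s (fun i => y *: m i)) => [x xJ n n'|a n x xJ|i ir|].
  - exact: bDr.
  - rewrite to_fractionM bZ //.
  - by rewrite inE -sP // mulrC; apply: idealM => //; apply: cJ.
  rewrite -[RHS]sum0 !big_seq; apply: eq_bigr => i ir.
  have -> : s i *: (y *: m i : restr phi) = phi (s i) * (val y * m i) by [].
  have <- : val (c i) * phi t = phi (s i) by exact: (congr1 val (sP i ir)).
  by rewrite mulrA -[_ * _ * val y]mulrA [phi t * _]vty mulr1.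
rewrite -[RHS]sumE !big_seq; apply: eq_bigr => i ir.
by rewrite -sP // mulrC bZ ?cJ // scalerA ty scale1r.
Qed.

End FractionSubring.

(** The Artinian local subring consists of the fractions of the image of [S]: it
    is Noetherian, its nonunits are nilpotent like those of [A], and [A] remains
    flat over it.  Conversely an Artinian ring is Noetherian and free modules are
    flat. *)
Lemma nilprimary_flat_over_noetherian (A : comNzRingType) : nilprimary A ->
  flat_over_noetherian A <->
  exists B : subringClosed A,
    [/\ artinian (subring B), local_ring (subring B) &
        free_module (restr (subring_incl B))].
Proof.
move=> npA; split=> [[S [phi [noethS flatA]]]|[B [artB _ freeB]]].
  have npB := fraction_nilprimary (phi := phi) npA.
  have noethB := fraction_noetherian (phi := phi) noethS.
  exists (fraction_subring phi); split.
  - exact: noetherian_artinian.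
  - exact: nilprimary_local.
  - by apply: ideal_flat_free => //; apply/fraction_ideal_flat/flat_ideal_flat.
exists (subring B), (subring_incl B); split; first exact: artinian_noetherian.
exact: free_flat.
Qed.


(** * Localization at a minimal prime *)

Section LocalizationTheory.
Variables (R : comNzRingType) (P : prime_idealr R).
Local Notation L := (localization P).

Definition to_localization (r : R) : L := \pi_L%qT (Localization.embed P r).

Fact to_localization_zmod : zmod_morphism to_localization.
Proof.
move=> x y; rewrite -[RHS]/(Localization.add _ (Localization.opp _)) !piE.
by apply: Localization.eq_frac; rewrite /= !mulr1.
Qed.

Fact to_localization_monoid : monoid_morphism to_localization.
Proof.
split=> [|x y]; first by rewrite -[1 in RHS]/(Localization.one P) !piE.
rewrite -[_ * _ in RHS]/(Localization.mul _ _) !piE.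
by apply: Localization.eq_frac; rewrite /= !mulr1.
Qed.

HB.instance Definition _ := GRing.isZmodMorphism.Build R L to_localization
  to_localization_zmod.
HB.instance Definition _ := GRing.isMonoidMorphism.Build R L to_localization
  to_localization_monoid.

Lemma to_localization_eq0 r :
  to_localization r = 0 <-> exists2 u, u \notin P & u * r = 0.
Proof.
rewrite -[0 in X in X <-> _]/(Localization.zero P) !piE.
split=> [/eqmodP/Localization.frac_eqP[u uP /=]|[u uP ur]].
  by rewrite !mulr1 mulr0; exists u.
by apply/eqmodP/Localization.frac_eqP; exists u; rewrite //= !mulr1 mulr0.
Qed.

Lemma to_localization_unit r : r \notin P -> exists y, to_localization r * y = 1.
Proof.
move=> rP; exists (\pi_L%qT (@Localization.Fraction R P (1, r) rP)).
rewrite -[LHS]/(Localization.mul _ _) -[RHS]/(Localization.one P) !piE.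
by apply: Localization.eq_frac; rewrite /= !mulr1 !mul1r.
Qed.

Lemma localizationP (x : L) : exists r s y,
  [/\ s \notin P, to_localization s * y = 1 & x = to_localization r * y].
Proof.
elim/quotW: x => -[[r s] /= sP]; exists r, s.
exists (\pi_L%qT (@Localization.Fraction R P (1, s) sP)); split=> //.
  rewrite -[LHS]/(Localization.mul _ _) -[RHS]/(Localization.one P) !piE.
  by apply: Localization.eq_frac; rewrite /= !mulr1 !mul1r.
rewrite -[_ * _]/(Localization.mul _ _) !piE.
by apply: Localization.eq_frac; rewrite /= !mulr1 !mul1r.
Qed.

(** If no such product vanishes, the products [u * r ^+ n] with [u] outside [P]
    form a multiplicative set without zero.  An ideal maximal among those
    avoiding it is a prime inside [P] that does not contain [r]. *)
Lemma minimal_prime_nilpotent r : minimal_prime P -> r \in P ->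
  exists u n, u \notin P /\ u * r ^+ n = 0.
Proof.
move=> minP rP; apply: contrapT => T0.
pose T x := exists u n, u \notin P /\ x = u * r ^+ n.
have TM x y : T x -> T y -> T (x * y).
  move=> [u [m [uP ->]]] [v [n [vP ->]]]; exists (u * v), (m + n)%N.
  by rewrite Localization.notinM // exprD mulrACA.
have T1 : T 1 by exists 1, 0%N; rewrite mulr1 Localization.notin1.
pose avoids (X : set R) := forall x, span (M := R^o) X x -> ~ T x.
have [F Fav totF x spx|X [avX maxX]] := @Zorn_bigcup R avoids.
  have [F0|/nonemptyPn F0] := pselect (F !=set0).
    have [X FX spX] := @span_bigcup R R^o F x totF F0 spx.
    exact: Fav FX x spX.
  suff -> : x = 0 by move=> [u [n [uP u0]]]; apply: T0; exists u, n.
  by move: spx; rewrite F0 bigcup_set0; elim.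
pose Q : R -> bool := fun x => `[< span (M := R^o) X x >].
have Qid : is_ideal (Q : {pred R}) by exact: span_ideal.
have avQ x : x \in (Q : {pred R}) -> ~ T x by move=> /asboolP; apply: avX.
have Q1 : 1 \notin (Q : {pred R}) by apply/negP => /avQ.
have enlarge a : a \notin (Q : {pred R}) ->
    exists x c, T x /\ x - c * a \in (Q : {pred R}).
  move=> aQ; apply: contrapT => noT; apply: (maxX (X `|` [set a])).
    split=> [x Xx|sub]; first by left.
    by case/negP: aQ; apply/asboolP/(@mem_span R R^o)/sub; right.
  move=> x /(@span_add_vector R R^o)[c xca] Tx; apply: noT; exists x, c.
  by split=> //; apply/asboolP.
have Qprime : prime_idealr_closed Q.
  move=> a b abQ; apply: contraT; rewrite negb_or => /andP[aQ bQ].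
  have [x [c [Tx xQ]]] := enlarge a aQ; have [y [d [Ty yQ]]] := enlarge b bQ.
  suff /avQ : x * y \in (Q : {pred R}) by case; exact: TM.
  have -> : x * y = y * (x - c * a) + (c * a) * (y - d * b) + c * d * (a * b).
    rewrite !mulrBr [c * a * (d * b)]mulrACA [y * (c * a)]mulrC.
    by rewrite addrA !subrK mulrC.
  apply: (idealD Qid); last exact: (idealM _ Qid).
  by apply: (idealD Qid); exact: (idealM _ Qid).
have Qclosed : idealr_closed Q by case: Qid => Q0 Qlin; split.
pose QQ : prime_idealr R := HB.pack Q (isIdealr.Build R Q Qclosed)
  (isPrimeIdealrClosed.Build R Q Qprime).
have QP : {subset QQ <= P}.
  move=> x xQ; apply: contraT => xP; case: (avQ x xQ).
  by exists x, 0%N; rewrite mulr1.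
have := minP QQ QP r; rewrite rP => /avQ; apply.
by exists 1, 1%N; rewrite mul1r Localization.notin1.
Qed.

Lemma localization_nilprimary : minimal_prime P -> nilprimary L.
Proof.
move=> minP x; have [r [s [y [sP sy ->]]]] := localizationP x.
have [rP|/to_localization_unit[z rz]] := boolP (r \in P); last first.
  by left; exists (z * to_localization s); rewrite mulrACA rz mul1r mulrC.
right; rewrite mulrC; apply: nilpotentM.
have [u [n [uP urn]]] := minimal_prime_nilpotent minP rP; exists n.
by rewrite -rmorphXn; apply/to_localization_eq0; exists u.
Qed.

End LocalizationTheory.

(** * Additive torsion *)

(** The torsion elements form an ideal, and the finitely many generators have a
    common exponent. *)
Lemma noetherian_torsion (S : comNzRingType) : noetherian S ->
  exists2 N, (0 < N)%N & forall (k : nat) (s : S), (0 < k)%N -> s *+ k = 0 -> s *+ N = 0.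
Proof.
move=> noethS; pose T : {pred S} := [pred s | `[< exists2 k, (0 < k)%N & s *+ k = 0 >]].
have Tid : is_ideal T.
  split=> [|a u v]; first by apply/asboolP; exists 1%N.
  move=> /asboolP[k k0 uk] /asboolP[l l0 vl]; apply/asboolP.
  exists (k * l)%N; first by rewrite muln_gt0 k0.
  by rewrite mulrnDl mulrnA -mulrnAr uk mulr0 mul0rn add0r mulnC mulrnA vl mul0rn.
have [l [lT Tl]] := (finitely_generatedP Tid).1 (noethS T Tid).
have [N N0 lN] : exists2 N, (0 < N)%N & {in l, forall s, s *+ N = 0}.
  elim: l lT {Tl} => [|s l IH] lT; first by exists 1%N.
  have [|N N0 lN] := IH; first by move=> x xl; apply: lT; rewrite in_cons xl orbT.
  have := lT s; rewrite mem_head => /(_ isT)/asboolP[k k0 sk].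
  exists (k * N)%N; first by rewrite muln_gt0 k0.
  move=> x; rewrite in_cons => /orP[/eqP->|/lN xN]; first by rewrite mulrnA sk mul0rn.
  by rewrite mulnC mulrnA xN mul0rn.
exists N => // k s k0 sk; have /Tl : s \in T by apply/asboolP; exists k.
by elim=> [|c b y /= /lN bN _ yN]; rewrite ?mul0rn // mulrnDl yN -mulrnAr bN mulr0 addr0.
Qed.

(** On the ideal [k S] the map sending [(k s, x)] to [N s x] is well defined,
    because [N] kills the [k]-torsion of [S], and balanced.  At [(k, x)] it
    takes the value [N x], which vanishes when [k x = 0]. *)
Lemma flat_torsion (S R : comNzRingType) (phi : {rmorphism S -> R}) (N k : nat) (x : R) :
  ideal_flat (restr phi) -> (forall s : S, s *+ k = 0 -> s *+ N = 0) ->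
  x *+ k = 0 -> x *+ N = 0.
Proof.
move=> flatR torS xk.
pose J : {pred S} := [pred s | `[< exists s', s = s' *+ k >]].
have Jid : is_ideal J.
  split=> [|a u v]; first by apply/asboolP; exists 0; rewrite mul0rn.
  move=> /asboolP[u' ->] /asboolP[v' ->]; apply/asboolP; exists (a * u' + v').
  by rewrite mulrnDl mulrnAr.
have /choice[g gP] s : exists s', s \in J -> s = s' *+ k.
  have [/asboolP[s' ->]|sJ] := boolP (s \in J); first by exists s'.
  by exists 0.
have gE s t : s \in J -> s = t *+ k -> phi (g s) *+ N = phi t *+ N.
  move=> sJ st; apply/eqP; rewrite -subr_eq0 -mulrnBl -rmorphB -rmorphMn torS ?rmorph0 //.
  by rewrite mulrnBl -gP // st subrr.
have kJ : k%:R \in J by apply/asboolP; exists 1.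
have : \sum_(i <- [:: tt]) (phi (g k%:R) *+ N) * x = 0.
  apply: (flatR J Jid _ (fun s (x : R) => (phi (g s) *+ N) * x) _ _ _ _ [:: tt]
    (fun=> k%:R) (fun=> x)) => //.
  - move=> n s t sJ tJ; rewrite -mulrDl -mulrnDl -rmorphD; congr (_ * _).
    by apply: gE; [exact: idealD|rewrite mulrnDl -!gP].
  - by move=> s _ m n; rewrite -mulrDr.
  - move=> s n t tJ; rewrite -[s *: n]/(phi s * n) mulrA [_ *+ N * phi s]mulrnAl -rmorphM.
    congr (_ * _); apply: gE; first exact: idealM.
    by rewrite [g t * s]mulrC -mulrnAr -gP.
  by rewrite big_seq1 -[_ *: _]/(phi k%:R * x) rmorph_nat mulr_natl.
by rewrite big_seq1 (gE _ 1) // rmorph1 mulrnAl mul1r.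
Qed.

Theorem theorem8 (R : comNzRingType) :
  (forall P : prime_idealr R, minimal_prime P ->
     (flat_over_noetherian (localization P) <->
      exists B : subringClosed (localization P),
        [/\ artinian (subring B), local_ring (subring B) &
            free_module (restr (subring_incl B))])) /\
  (flat_over_noetherian R ->
   finite_set [set ring_char (localization P) | P in @minimal_prime R]).
Proof.
split=> [P /localization_nilprimary/nilprimary_flat_over_noetherian//|].
move=> [S [phi [noethS /flat_ideal_flat flatR]]].
have [N N0 torS] := noetherian_torsion noethS.
apply: (@sub_finite_set _ _ (Posz @` `I_N.+1)); last exact: finite_image.
move=> _ [P _ <-]; have [] := ring_charP (localization P).
case: (ring_char _) => // -[|k] _ charP; first by exists 0%N.
have : to_localization P k.+1%:R = 0.
  by rewrite rmorph_nat; apply/(charP k.+1).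
move=> /to_localization_eq0[u uP]; rewrite mulr_natr => uk.
have uN : u *+ N = 0 by apply: flat_torsion flatR _ uk => s; apply: torS.
have /(charP N) : N%:R = 0 :> localization P.
  rewrite -(rmorph_nat (to_localization P)); apply/to_localization_eq0.
  by exists u; rewrite // mulr_natr.
by move=> /dvdn_leq kN; exists k.+1 => //=; rewrite ltnS kN.
Qed.
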